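(* Let $I=\{(p,\lambda): 0<p\le 1,\ 0<\lambda\}$ and $II=\{(p,\lambda): 1<p\le \tfrac32,\ 0<\lambda\le \tfrac{9p}{10}\}$, let $(p,\lambda)\in I\cup II$, and put $$R_{\lambda,p}=\begin{cases}\dfrac{-p-\lambda+\sqrt{\lambda^2+4p\lambda}}{2\lambda-p}, & p\neq 2\lambda,\\[2mm] \dfrac13, & p=2\lambda.\end{cases}$$ Then for every analytic function $f(z)=\sum_{k=0}^\infty a_kz^k$ on $\mathbb{D}$ with $|f(z)|<1$ for all $z\in\mathbb{D}$, $$|f(z)|^{p}+\lambda\sum_{k=1}^{\infty}|a_{k}||z|^{k}\leq 1\qquad\text{for all } z \text{ with } |z|=r\le R_{\lambda,p}.$$ Furthermore, the radius $R_{\lambda,p}$ is sharp.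
   Context: $\mathbb{D}=\{z\in\mathbb{C}:|z|<1\}$ is the open unit disk. The radius $R_{\lambda,p}$ being sharp (best possible) means that, for the given $(p,\lambda)$, it cannot be replaced by any larger number: for every $R'$ with $R_{\lambda,p}<R'<1$ there are an analytic $f(z)=\sum_{k\ge0} a_kz^k$ on $\mathbb{D}$ with $|f|<1$ on $\mathbb{D}$ and a point $z$ with $|z|\le R'$ for which the inequality fails. *)

(* Defs.v *)
From HB Require Import structures.
From mathcomp Require Import all_boot all_order all_algebra.
From mathcomp Require Import complex.
From mathcomp Require Import all_classical all_reals all_analysis.

Set Implicit Arguments.
Unset Strict Implicit.
Unset Printing Implicit Defensive.

Import Order.TTheory GRing.Theory Num.Theory.
Import numFieldNormedType.Exports.

Local Open Scope classical_set_scope.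
Local Open Scope ring_scope.
Local Open Scope complex_scope.

(* The norm `|z| of z : R[i] lives in R[i]; [cmod z] is the same modulus
   as an element of R. *)
Definition cmod (R : realType) (z : R[i]) : R := ComplexField.Normc.normc z.

(* f(z) = \sum_(k >= 0) a_k z^k at every point of the open unit disk. The
   function f is total on R[i]; its values off the disk are irrelevant. *)
Definition analytic_on_disk (R : realType) (a : nat -> R[i])
    (f : R[i] -> R[i]) : Prop :=
  forall z : R[i], cmod z < 1 ->
    series (fun k => a k * z ^+ k : R[i]^o) @ \oo --> (f z : R[i]^o).

Definition bounded_analytic (R : realType) (a : nat -> R[i])
    (f : R[i] -> R[i]) : Prop :=
  analytic_on_disk a f /\ forall z : R[i], cmod z < 1 -> cmod (f z) < 1.

Definition region_I (R : realType) (p lam : R) : Prop :=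
  0 < p <= 1 /\ 0 < lam.

Definition region_II (R : realType) (p lam : R) : Prop :=
  1 < p <= 3 / 2 /\ 0 < lam <= 9 * p / 10.

Definition bohr_radius (R : realType) (p lam : R) : R :=
  if p == 2 * lam then 1 / 3
  else (- p - lam + Num.sqrt (lam ^+ 2 + 4 * p * lam)) / (2 * lam - p).

(* The series has nonnegative terms and is summed in [0, +oo], so the
   inequality includes its convergence. Here x `^ p is the real power,
   with 0 `^ p = 0 when p > 0. *)
Definition bohr_inequality (R : realType) (p lam : R) (a : nat -> R[i])
    (f : R[i] -> R[i]) (z : R[i]) : Prop :=
  ((cmod (f z) `^ p)%:E +
    lam%:E * \sum_(1 <= k <oo) (cmod (a k) * cmod z ^+ k)%:E <= 1)%E.

(* Main.v *)
Require Import Defs.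
From mathcomp Require Import all_boot all_order all_algebra.
From mathcomp Require Import cyclic separable cyclotomic ring lra.
From mathcomp Require Import complex.
From mathcomp Require Import all_classical all_reals all_analysis.
Import Order.TTheory GRing.Theory Num.Theory.
Import numFieldNormedType.Exports.
Local Open Scope ring_scope.

(** Write a = |a_0| and r = |z|. Two classical facts about f carry the proof:
    Wiener's bound |a_k| <= 1 - a^2 for k >= 1 ([wiener_coef_bound]) and the
    Schwarz-Pick bound |f(z)| <= (a + r) / (1 + a r) ([schwarz_pick]). The
    second gives 1 - |f(z)|^2 >= (1 - a^2) (1 - r) / (1 + r), and for
    0 < p <= 2 concavity of y^(p/2) gives
    |f(z)|^p <= 1 - (p/2) (1 - |f(z)|^2). By the first the series is at most
    (1 - a^2) r / (1 - r). So the inequality follows from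
    lam r / (1 - r) <= (p/2) (1 - r) / (1 + r), and this is exactly
    r <= R_(lam,p) ([le_bohr_radius]).

    Both facts are consequences of one principle: multiplication by a
    function bounded by 1 does not increase the sum of the squared moduli of
    the coefficients ([multiplier_contraction]). For a polynomial this is
    Parseval's identity, here with the unit circle replaced by the n-th roots
    of unity, n large. Applying it to the test functions x + y X^k gives
    Wiener's bound ([wiener_poly]); applying it to truncations of the
    reproducing kernel at w gives the positivity of the 2 x 2 Pick matrix,
    hence Schwarz-Pick ([pick_quadratic], [schwarz_pick_poly]). The step from
    polynomials to f uses the Taylor polynomials of f(z / M) / M with M > 1,
    which are eventually bounded by 1 on the unit circle
    ([scaled_taylor_le1]), and then M tends to 1.

    Sharpness: for f(z) = (t + z) / (1 + t z) at z = r > 0 all the estimates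
    above are equalities to first order in 1 - t, so beyond the radius the
    inequality fails for t close to 1 ([sharpness_gap]). *)

(** * Parseval's identity at roots of unity and multipliers *)

Lemma primitive_root_exists (C : numClosedFieldType) (n : nat) :
  (0 < n)%N -> exists z : C, n.-primitive_root z.
Proof.
pose p : {poly C} := 'X^n - 1; have [r Dp] := closed_field_poly_normal p.
move=> n_gt0; rewrite (monicP _) ?monicXnsubC // scale1r in Dp.
have rn1 : all n.-unity_root r by apply/allP=> z; rewrite -root_prod_XsubC -Dp.
have sz_r : (n < (size r).+1)%N.
  by rewrite -(size_prod_XsubC r id) -Dp size_XnsubC.
have [|z] := hasP (has_prim_root n_gt0 rn1 _ sz_r); last by exists z.
by rewrite -separable_prod_XsubC -Dp separable_Xn_sub_1 // pnatr_eq0 -lt0n.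
Qed.

Lemma norm_primitive_root (C : numClosedFieldType) (n : nat) (w : C) :
  n.-primitive_root w -> `|w| = 1.
Proof.
move=> wn; have n0 := prim_order_gt0 wn.
apply/eqP; rewrite -(@pexpr_eq1 _ _ n) ?normr_ge0 //.
by rewrite -normrX (prim_expr_order wn) normr1.
Qed.

(** Orthogonality of the characters of a cyclic group: off the diagonal the
    ratio is a nontrivial n-th root of unity, whose powers sum to 0. The
    conjugate of a point of the unit circle is its inverse. *)
Lemma sum_primitive_root_ratio (C : numClosedFieldType) (n : nat) (w : C)
    (k l : 'I_n) : n.-primitive_root w ->
  \sum_(j < n) (w ^+ k * (w ^+ l)^* ) ^+ j = n%:R * (k == l)%:R :> C.
Proof.
move=> wn; have w1 := norm_primitive_root _ _ _ wn.
have w0 : w != 0 by rewrite -normr_eq0 w1 oner_eq0.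
have wl : (w ^+ l)^* = (w ^+ l)^-1.
  by rewrite invC_norm normrX w1 !expr1n invr1 mul1r.
rewrite wl; set q := _ / _.
have [e|kl] := eqVneq k l.
  have -> : q = 1 by rewrite /q e divff ?expf_neq0.
  by rewrite mulr1 (eq_bigr (fun=> 1)) ?sumr_const ?card_ord // => i _; rewrite expr1n.
rewrite mulr0; have q1 : q != 1.
  rewrite /q -subr_eq0; apply/eqP => /eqP; rewrite subr_eq0 => /eqP e.
  move/(congr1 ( *%R^~ (w ^+ l))): e; rewrite mulfVK ?expf_neq0 // mul1r => /eqP.
  rewrite (eq_prim_root_expr wn) !modn_small // => /eqP /val_inj kl'.
  by rewrite kl' eqxx in kl.
apply: (mulfI (x := q - 1)); first by rewrite subr_eq0.
rewrite -subrX1 mulr0 /q exprMn exprVn -!exprM ![(_ * n)%N]mulnC !exprM.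
by rewrite (prim_expr_order wn) !expr1n invr1 mulr1 subrr.
Qed.

(** Sampling at the n-th roots of unity is exact for polynomials of size at
    most n, so this finite sum plays the part of the integral over the
    circle. *)
Lemma parseval_roots (C : numClosedFieldType) (n : nat) (w : C) (p : {poly C}) :
  n.-primitive_root w -> (size p <= n)%N ->
  \sum_(j < n) `|p.[w ^+ j]| ^+ 2 = n%:R * \sum_(k < n) `|p`_k| ^+ 2.
Proof.
move=> wn sp.
transitivity (\sum_(j < n) \sum_(k < n) \sum_(l < n)
    (p`_k * (p`_l)^* ) * (w ^+ k * (w ^+ l)^* ) ^+ j).
  apply: eq_bigr => j _; rewrite normCK (horner_coef_wide _ sp) rmorph_sum.
  rewrite mulr_suml; apply: eq_bigr => k _; rewrite mulr_sumr.
  apply: eq_bigr => l _; rewrite rmorphM /= exprMn -rmorphXn.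
  by rewrite ![(w ^+ j) ^+ _]exprAC mulrACA.
rewrite exchange_big mulr_sumr; apply: eq_bigr => k _ /=.
rewrite exchange_big /=.
under eq_bigr => l _ do rewrite -mulr_sumr sum_primitive_root_ratio //.
rewrite (bigD1 k) //= eqxx big1 => [|l lk]; last by rewrite eq_sym (negbTE lk) !mulr0.
by rewrite normCK addr0 mulr1 mulrC.
Qed.

(** Multiplication by a function bounded by 1 contracts the Hardy space H^2:
    the factor P only shrinks the samples of g on the circle, and Parseval
    converts samples into coefficients. *)
Lemma multiplier_contraction (C : numClosedFieldType) (P g : {poly C}) (n : nat) :
    (forall z, `|z| = 1 -> `|P.[z]| <= 1) ->
    (size (P * g)%R <= n)%N -> (size g <= n)%N ->
  \sum_(k < n) `|(P * g)`_k| ^+ 2 <= \sum_(k < n) `|g`_k| ^+ 2.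
Proof.
move=> P1 sPg sg.
have [->|n0] := posnP n; first by rewrite !big_ord0.
have [w wn] := primitive_root_exists C n n0.
have nC : 0 < n%:R :> C by rewrite ltr0n.
rewrite -(ler_pM2l nC) -!(parseval_roots C n w) //; apply: ler_sum => j _.
rewrite hornerM normrM exprMn ler_piMl ?sqr_ge0 ?exprn_ge0 // expr_le1 ?normr_ge0 //.
by apply: P1; rewrite normrX (norm_primitive_root _ _ _ wn) expr1n.
Qed.

(** With S the energy of u and T the sum on the left, the vector
    S h - T conj(u) has energy S (S E - |T|^2), which is nonnegative. *)
Lemma cauchy_schwarz_sum (C : numClosedFieldType) (n : nat) (h u : 'I_n -> C) :
  `|\sum_k h k * u k| ^+ 2 <= (\sum_k `|h k| ^+ 2) * \sum_k `|u k| ^+ 2.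
Proof.
set T := \sum_k h k * u k; set E := \sum_k `|h k| ^+ 2.
pose S := \sum_k `|u k| ^+ 2; rewrite -/S.
have S0 : 0 <= S by apply: sumr_ge0 => k _; rewrite exprn_ge0.
have [S_eq0|S_neq0] := eqVneq S 0.
  have u0 k : u k = 0.
    have /eqP : `|u k| ^+ 2 = 0.
      by apply: (psumr_eq0P _ S_eq0) => // i _; rewrite exprn_ge0.
    by rewrite expf_eq0 normr_eq0 => /andP[_ /eqP].
  by rewrite S_eq0 /T big1 => [|k _]; rewrite ?u0 ?mulr0 // normr0 expr0n.
have {S_neq0}S_gt0 : 0 < S by rewrite lt_def S_neq0.
rewrite -subr_ge0 -(pmulr_rge0 _ S_gt0).
suff -> : S * (E * S - `|T| ^+ 2) = \sum_k `|S * h k - T * (u k)^* | ^+ 2.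
  by apply: sumr_ge0 => k _; rewrite exprn_ge0.
transitivity (\sum_k (S ^+ 2 * `|h k| ^+ 2 - S * T^* * (h k * u k)
   - S * T * (h k * u k)^* + `|T| ^+ 2 * `|u k| ^+ 2)).
  rewrite !big_split /= !sumrN -!mulr_sumr -rmorph_sum -/T -/S -/E normCK; ring.
apply: eq_bigr => k _; rewrite !normCK rmorphB /= !rmorphM /= conjCK (geC0_conj S0); ring.
Qed.

Lemma ler_sum_two (R : numDomainType) (n : nat) (F : nat -> R) (i j : nat) :
    (forall k, 0 <= F k) -> (i < n)%N -> (j < n)%N -> i != j ->
  F i + F j <= \sum_(k < n) F k.
Proof.
move=> F0 ni nj ij; rewrite (bigD1 (Ordinal ni)) //= lerD2l.
rewrite (bigD1 (Ordinal nj)) //= ?lerDl ?sumr_ge0 //.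
by rewrite -val_eqE eq_sym.
Qed.

Lemma sum_even_powers (R : comNzRingType) (r : R) (n : nat) :
  (1 - r ^+ 2) * (\sum_(i < n) r ^+ (2 * i.+1)) = r ^+ 2 * (1 - (r ^+ 2) ^+ n).
Proof.
rewrite -[1 - _ ^+ n]opprB subrX1.
under eq_bigr => i _ do rewrite exprM exprS.
rewrite -mulr_sumr; ring.
Qed.

(** * The real-valued modulus *)

Local Open Scope complex_scope.

(** The bridge between the norm of the library, which takes values in R[i],
    and the real-valued modulus. *)
Lemma normE_cmod (R : realType) (z : R[i]) : `|z| = (cmod z)%:C.
Proof. by []. Qed.

Lemma cmod_ge0 (R : realType) (z : R[i]) : 0 <= cmod z.
Proof. by rewrite -lecR -normE_cmod normr_ge0. Qed.

Lemma cmod0 (R : realType) : cmod (0 : R[i]) = 0.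
Proof. exact: ComplexField.Normc.normc0. Qed.

Lemma cmod1 (R : realType) : cmod (1 : R[i]) = 1.
Proof. exact: ComplexField.Normc.normc1. Qed.

Lemma cmod_eq0 (R : realType) (z : R[i]) : (cmod z == 0) = (z == 0).
Proof.
apply/eqP/eqP => [|->]; last exact: cmod0.
exact: ComplexField.Normc.eq0_normc.
Qed.

Lemma cmodM (R : realType) (y z : R[i]) : cmod (y * z) = cmod y * cmod z.
Proof. exact: ComplexField.Normc.normcM. Qed.

Lemma cmodX (R : realType) (z : R[i]) (n : nat) : cmod (z ^+ n) = cmod z ^+ n.
Proof. by apply: complexI; rewrite rmorphXn -!normE_cmod normrX. Qed.

Lemma cmodD (R : realType) (y z : R[i]) : cmod (y + z) <= cmod y + cmod z.
Proof. by rewrite -lecR rmorphD -!normE_cmod ler_normD. Qed.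

Lemma cmodN (R : realType) (z : R[i]) : cmod (- z) = cmod z.
Proof. by apply: complexI; rewrite -!normE_cmod normrN. Qed.

Lemma cmod_sum (R : realType) (n : nat) (h : 'I_n -> R[i]) :
  cmod (\sum_k h k) <= \sum_k cmod (h k).
Proof.
by rewrite -lecR rmorph_sum -normE_cmod ler_norm_sum.
Qed.

Lemma cmod_real (R : realType) (x : R) : 0 <= x -> cmod x%:C = x.
Proof. by move=> x0; rewrite /cmod /= expr0n addr0 sqrtr_sqr ger0_norm. Qed.

Lemma cmod_conj (R : realType) (z : R[i]) : cmod z^* = cmod z.
Proof. by case: z => a b; rewrite /cmod /= sqrrN. Qed.

Lemma sqr_cmod (R : realType) (z : R[i]) :
  cmod z ^+ 2 = complex.Re z ^+ 2 + complex.Im z ^+ 2.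
Proof. by case: z => a b; rewrite /cmod /= sqr_sqrtr // addr_ge0 ?sqr_ge0. Qed.

Lemma cmod_conjM (R : realType) (z : R[i]) : z^* * z = (cmod z ^+ 2)%:C.
Proof.
rewrite sqr_cmod; case: z => x y /=; apply/eqP; rewrite eq_complex /=.
by apply/andP; split; apply/eqP; ring.
Qed.

Lemma energy_cmod (R : realType) (n : nat) (h : 'I_n -> R[i]) :
  (\sum_k cmod (h k) ^+ 2)%:C = \sum_k `|h k| ^+ 2.
Proof.
by rewrite rmorph_sum; apply: eq_bigr => k _; rewrite normE_cmod -rmorphXn.
Qed.

Lemma multiplier_contraction_cmod (R : realType) (P g : {poly R[i]}) (n : nat) :
    (forall z, cmod z = 1 -> cmod P.[z] <= 1) ->
    (size (P * g)%R <= n)%N -> (size g <= n)%N ->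
  \sum_(k < n) cmod (P * g)`_k ^+ 2 <= \sum_(k < n) cmod g`_k ^+ 2.
Proof.
move=> P1 sPg sg; rewrite -lecR !energy_cmod.
apply: multiplier_contraction => // z; rewrite !normE_cmod => /complexI /P1.
by rewrite -lecR.
Qed.

Lemma cauchy_schwarz_cmod (R : realType) (n : nat) (h u : 'I_n -> R[i]) :
  cmod (\sum_k h k * u k) ^+ 2 <=
    (\sum_k cmod (h k) ^+ 2) * \sum_k cmod (u k) ^+ 2.
Proof.
rewrite -lecR rmorphXn rmorphM /= !energy_cmod -normE_cmod.
exact: cauchy_schwarz_sum.
Qed.

(** * Polynomials bounded by 1 on the unit circle *)

(** Wiener's inequality. On test functions x + y X^k the contraction
    property only sees the 2 x 2 lower triangular block with diagonal
    A = P_0 and corner c = P_k. The choice x = 1 - |A|^2, y = conj(A) c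
    makes the coefficient of X^k in the product equal to c, and the energy
    inequality becomes (1 - |A|^2) |c|^2 <= (1 - |A|^2)^3. *)
Lemma wiener_poly (R : realType) (P : {poly R[i]}) (k : nat) :
    (forall z, cmod z = 1 -> cmod P.[z] <= 1) -> cmod P`_0 < 1 -> (0 < k)%N ->
  cmod P`_k <= 1 - cmod P`_0 ^+ 2.
Proof.
move=> P1 A1 k0; set A := P`_0; set c := P`_k; set al := 1 - _.
have A0 := cmod_ge0 _ A.
have al0 : 0 < al by rewrite subr_gt0 expr_lt1.
pose x : R[i] := al%:C; pose y := A^* * c.
pose g := x%:P + y *: 'X^k.
pose n := (size (P * g)%R + size g + k).+1.
have := multiplier_contraction_cmod _ _ g n P1.
have n1 : (size (P * g)%R <= n)%N by rewrite /n -addnA -addnS leq_addr.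
have n2 : (size g <= n)%N by rewrite /n addnAC -addSn leq_addl.
have n3 : (k < n)%N by rewrite ltnS leq_addl.
move=> /(_ n1 n2).
have := ler_sum_two _ n (fun i => cmod (P * g)`_i ^+ 2) 0 k.
rewrite /= eq_sym -lt0n => /(_ (fun i => sqr_ge0 _) isT n3 k0) h1 h2.
have {h1 h2} := le_trans h1 h2.
rewrite (bigD1 (Ordinal (ltn0Sn _ : 0 < n)%N)) //= (bigD1 (Ordinal n3)) //=; last first.
  by rewrite -val_eqE /= -lt0n.
rewrite big1 => [|i /andP[i0 ik]]; last first.
  rewrite /g coefD coefC coefZ coefXn.
  rewrite -!val_eqE /= in i0 ik.
  by rewrite (negbTE i0) (negbTE ik) mulr0 addr0 -[RHS](expr0n _ 2) cmod0.
have -> : (P * g)`_0 = A * x.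
  by rewrite /g mulrDr coefD coefMC -scalerAr coefZ coefMXn k0 mulr0 addr0.
have -> : (P * g)`_k = c.
  rewrite /g mulrDr coefD coefMC -scalerAr coefZ coefMXn ltnn subnn.
  rewrite -/A -/c /y [_ * c * A]mulrAC cmod_conjM /x mulrC -mulrDl -rmorphD /=.
  by rewrite subrK mul1r.
have -> : g`_0 = x.
  rewrite /g coefD coefC coefZ coefXn eqxx /= eq_sym -[k == 0]negbK -lt0n k0.
  by rewrite mulr0 addr0.
have -> : g`_k = y.
  by rewrite /g coefD coefC coefZ coefXn eqxx /= -[k == 0]negbK -lt0n k0 mulr1 add0r.
rewrite addr0 !cmodM cmod_conj cmod_real ?(ltW al0) //.
rewrite !exprMn => h; have : al * cmod c ^+ 2 <= al * al ^+ 2.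
  have -> : al * cmod c ^+ 2 = cmod c ^+ 2 - cmod A ^+ 2 * cmod c ^+ 2.
    by rewrite /al; ring.
  have -> : al * al ^+ 2 = al ^+ 2 - cmod A ^+ 2 * al ^+ 2 by rewrite {1}/al; ring.
  lra.
rewrite ler_pM2l // ler_sqr // nnegrE ?cmod_ge0 //; exact: ltW.
Qed.

(** The test function is x plus c times a truncation of the reproducing
    kernel at w without its constant term. Its value at w is x + c S and its
    energy |x|^2 + |c|^2 S, so nothing is lost on its side; on the side of
    H = P g, Cauchy-Schwarz bounds H(w) - H(0) by the energy of the
    nonconstant coefficients of H. *)
Lemma pick_energy (R : realType) (P : {poly R[i]}) (w x c : R[i]) (m : nat)
    (S : R) :
    (forall z, cmod z = 1 -> cmod P.[z] <= 1) -> cmod w < 1 ->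
    S = \sum_(i < m) cmod w ^+ (2 * i.+1) ->
  (1 - cmod w ^+ 2) * cmod (P.[w] * (x + c * S%:C) - P`_0 * x) ^+ 2 <=
  cmod w ^+ 2 * (cmod x ^+ 2 + cmod c ^+ 2 * S - cmod (P`_0 * x) ^+ 2).
Proof.
move=> P1 w1 S_def; set r := cmod w; have r0 : 0 <= r := cmod_ge0 _ w.
pose g := \poly_(i < m.+1) (if i == 0 then x else c * w^* ^+ i).
have gS : g.[w] = x + c * S%:C.
  rewrite S_def horner_poly big_ord_recl /= mulr1 rmorph_sum mulr_sumr; congr (_ + _).
  apply: eq_bigr => i _; rewrite -mulrA -exprMn cmod_conjM -rmorphXn.
  by rewrite -exprM.
have gE : \sum_(i < m.+1) cmod g`_i ^+ 2 = cmod x ^+ 2 + cmod c ^+ 2 * S.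
  rewrite S_def big_ord_recl coef_poly /= mulr_sumr; congr (_ + _).
  apply: eq_bigr => i _; rewrite coef_poly /= /bump /= add1n ltnS ltn_ord.
  by rewrite cmodM cmodX cmod_conj exprMn -exprM mulnC.
pose n := (size (P * g)%R + m)%N.
have n1 : (size (P * g)%R <= n.+1)%N by rewrite /n ltnW // ltnS leq_addr.
have n2 : (size g <= n.+1)%N.
  by rewrite (leq_trans (size_poly _ _)) // ltnS leq_addl.
have H := multiplier_contraction_cmod _ _ g _ P1 n1 n2.
have gn : \sum_(i < n.+1) cmod g`_i ^+ 2 = \sum_(i < m.+1) cmod g`_i ^+ 2.
  have mn : (m.+1 <= n.+1)%N by rewrite ltnS leq_addl.
  rewrite (big_ord_widen _ (fun i => cmod g`_i ^+ 2) mn) [RHS]big_mkcond.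
  apply: eq_bigr => i _; case: ltnP => // mi.
  by rewrite nth_default ?(leq_trans (size_poly _ _)) // -[RHS](expr0n _ 2) cmod0.
move: H; rewrite gn gE big_ord_recl.
have -> : (P * g)`_0 = P`_0 * x.
  by rewrite coefM big_ord_recl big_ord0 /= coef_poly /= addr0.
set E := \sum_(i < n) _ => H.
have HT : P.[w] * (x + c * S%:C) - P`_0 * x = \sum_(i < n) (P * g)`_i.+1 * w ^+ i.+1.
  rewrite -gS -hornerM (horner_coef_wide _ n1) big_ord_recl expr0 mulr1 /=.
  by rewrite coefM big_ord_recl big_ord0 /= coef_poly /= addr0 addrAC subrr add0r.
have CS := cauchy_schwarz_cmod _ _ (fun i : 'I_n => (P * g)`_i.+1) (fun i => w ^+ i.+1).
rewrite HT; move: CS; rewrite -/E; set T := cmod _; set G := \sum_k _ => CS.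
have GS : (1 - r ^+ 2) * G <= r ^+ 2.
  have -> : G = \sum_(i < n) r ^+ (2 * i.+1).
    by apply: eq_bigr => i _; rewrite cmodX -exprM mulnC.
  by rewrite sum_even_powers ler_piMr ?sqr_ge0 // gerBl !exprn_ge0.
have E0 : 0 <= E by apply: sumr_ge0 => i _; rewrite sqr_ge0.
have r1 : 0 <= 1 - r ^+ 2 by rewrite subr_ge0 expr_le1 // ltW.
apply: (le_trans (ler_wpM2l r1 CS)).
rewrite mulrCA (le_trans (ler_wpM2l E0 GS)) // mulrC ler_wpM2l ?sqr_ge0 //.
by rewrite lerBrDr addrC.
Qed.

(** The powers start at q: the nonconstant part of the reproducing kernel
    vanishes when it is truncated at order 0. *)
Lemma le0_geometric_bound (R : realType) (q X Y : R) :
  0 <= q < 1 -> (forall m, X <= q ^+ m.+1 * Y) -> X <= 0.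
Proof.
move=> /andP[q0 q1] h.
have c : ((fun m => q ^+ m.+1 * Y) @ \oo --> 0 * Y)%classic.
  apply: cvgMl; rewrite (cvg_shiftS (fun m => q ^+ m)); apply: cvg_expr.
  by rewrite ger0_norm.
rewrite mul0r in c; rewrite -(cvg_lim _ c) //.
apply: limr_ge; first by apply/cvg_ex; exists 0.
by apply: nearW.
Qed.

(** Positivity of the Pick matrix of P at the nodes 0 and w, as a quadratic
    form in x and v. It is the limit of the energy inequality for
    c = (v - x) / S as the truncation order of the kernel tends to infinity;
    the truncation error is proportional to a power of |w|^2. *)
Lemma pick_quadratic (R : realType) (P : {poly R[i]}) (w x v : R[i]) :
    (forall z, cmod z = 1 -> cmod P.[z] <= 1) -> cmod w < 1 -> w != 0 ->
  (1 - cmod w ^+ 2) * cmod (P.[w] * v - P`_0 * x) ^+ 2 <=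
  cmod w ^+ 2 * (cmod x ^+ 2 - cmod (P`_0 * x) ^+ 2)
  + (1 - cmod w ^+ 2) * cmod (v - x) ^+ 2.
Proof.
move=> P1 w1 wn0; set r := cmod w.
have r0 : 0 < r by rewrite lt_def cmod_ge0 cmod_eq0 wn0.
rewrite -subr_le0.
set K1 := _ * cmod _ ^+ 2; set K2 := _ ^+ 2 * _; set K3 := _ * _.
have r2 : 0 <= r ^+ 2 < 1 by rewrite sqr_ge0 expr_lt1 // ltW.
apply: (@le0_geometric_bound _ (r ^+ 2) _ (K1 - K2)) => // m.
set e := _ ^+ m.+1.
have e1 : 0 <= e < 1.
  by case/andP: r2 => u0 u1; rewrite /e exprn_ge0 // exprn_ilt1.
pose S := \sum_(i < m.+1) r ^+ (2 * i.+1).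
have HS : (1 - r ^+ 2) * S = r ^+ 2 * (1 - e) by rewrite /S sum_even_powers.
have S0 : 0 < S.
  rewrite -(pmulr_rgt0 (x := 1 - r ^+ 2)) ?subr_gt0 ?expr_lt1 ?(ltW r0) //.
  by rewrite HS mulr_gt0 ?exprn_gt0 // subr_gt0; case/andP: e1.
have := pick_energy _ P w x ((v - x) * (S^-1)%:C) m.+1 S P1 w1 erefl.
rewrite -mulrA -rmorphM mulVf ?gt_eqF // mulr1 [x + _]addrC subrK -/r -/K1.
rewrite cmodM cmod_real ?invr_ge0 ?(ltW S0) // => H.
have {H} H : K1 <= K2 + r ^+ 2 * cmod (v - x) ^+ 2 / S.
  move: H; rewrite /K2; set V := cmod (v - x).
  suff -> : (V / S) ^+ 2 * S = V ^+ 2 / S by rewrite mulrDr mulrBr; lra.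
  by field; rewrite gt_eqF.
have e2 : 0 <= 1 - e by rewrite subr_ge0; case/andP: e1 => _ /ltW.
have := ler_wpM2l e2 H.
suff -> : (1 - e) * (K2 + r ^+ 2 * cmod (v - x) ^+ 2 / S) = (1 - e) * K2 + K3 by lra.
rewrite mulrDr; congr (_ + _).
transitivity (r ^+ 2 * (1 - e) * (cmod (v - x) ^+ 2 / S)); first by ring.
by rewrite -HS /K3; field; rewrite gt_eqF.
Qed.

(** The identity (1 - ab)^2 - (1 - a^2)(1 - b^2) = (b - a)^2 turns the
    determinant inequality of the Pick matrix, with d >= 1 - ab, into
    |b - a| <= r (1 - ab). *)
Lemma schwarz_pick_bound (R : realFieldType) (a b r d : R) :
    0 <= a < 1 -> 0 <= b -> 0 <= r < 1 -> 1 <= d + a * b -> 0 <= d ->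
    (1 - r ^+ 2) * d ^+ 2 <= (1 - a ^+ 2) * (1 - b ^+ 2) ->
  b * (1 + a * r) <= a + r.
Proof.
move=> /andP[a0 a1] b0 /andP[r0 r1] d1 d0 h.
have r2 : 0 < 1 - r ^+ 2 by rewrite subr_gt0 expr_lt1.
have a2 : 0 < 1 - a ^+ 2 by rewrite subr_gt0 expr_lt1.
have b1 : b <= 1.
  rewrite -(@expr_le1 _ 2) // -subr_ge0 -(pmulr_rge0 _ a2).
  by apply: le_trans h; rewrite mulr_ge0 ?sqr_ge0 // ltW.
have ab : 0 <= 1 - a * b by rewrite subr_ge0 mulr_ile1 // ltW.
have h2 : (1 - r ^+ 2) * (1 - a * b) ^+ 2 <= (1 - a ^+ 2) * (1 - b ^+ 2).
  apply: le_trans h; rewrite ler_wpM2l ?(ltW r2) // lerXn2r ?nnegrE //; lra.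
have h3 : (b - a) ^+ 2 <= (r * (1 - a * b)) ^+ 2.
  have -> : (b - a) ^+ 2 = (1 - a * b) ^+ 2 - (1 - a ^+ 2) * (1 - b ^+ 2) by ring.
  have -> : (r * (1 - a * b)) ^+ 2 =
      (1 - a * b) ^+ 2 - (1 - r ^+ 2) * (1 - a * b) ^+ 2 by ring.
  lra.
have h4 : b - a <= r * (1 - a * b).
  rewrite (le_trans (ler_norm _)) // -ler_sqr ?nnegrE ?mulr_ge0 //.
  by rewrite real_normK // num_real.
nra.
Qed.

(** The Pick form is evaluated at the vector x = (1 - r^2) conj(D),
    v = 1 - |A|^2, where its value is a positive multiple of the determinant
    of the Pick matrix. *)
Lemma schwarz_pick_poly (R : realType) (P : {poly R[i]}) (w : R[i]) :
    (forall z, cmod z = 1 -> cmod P.[z] <= 1) -> cmod P`_0 < 1 -> cmod w < 1 ->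
  cmod P.[w] * (1 + cmod P`_0 * cmod w) <= cmod P`_0 + cmod w.
Proof.
move=> P1 A1 w1.
have [->|w0] := eqVneq w 0; first by rewrite horner_coef0 cmod0 mulr0 !addr0 mulr1.
set A := P`_0 in A1 *; set B := P.[w]; set r := cmod w in w1 *.
pose D := 1 - A * B^*.
apply: (@schwarz_pick_bound _ _ _ _ (cmod D)); rewrite ?cmod_ge0 //.
  rewrite -(cmod1 R) -(cmod_conj _ B) -cmodM (le_trans _ (cmodD _ _ _)) //.
  by rewrite subrK.
have := pick_quadratic _ P w ((1 - r ^+ 2)%:C * D^*) (1 - cmod A ^+ 2)%:C P1 w1 w0.
have r2 : 0 < 1 - r ^+ 2 by rewrite subr_gt0 expr_lt1 // cmod_ge0.
have a2 : 0 < 1 - cmod A ^+ 2 by rewrite subr_gt0 expr_lt1 // cmod_ge0.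
rewrite -subr_ge0 -/r -/A -/B.
set L := _ - _ => L0.
have E : L = (1 - r ^+ 2) * (1 - cmod A ^+ 2) *
  ((1 - cmod A ^+ 2) * (1 - cmod B ^+ 2) - (1 - r ^+ 2) * cmod D ^+ 2).
  rewrite /L /D !sqr_cmod; case: (A) => a1 a2'; case: (B) => b1 b2 /=; ring.
by move: L0; rewrite E pmulr_rge0 ?subr_ge0 // mulr_gt0.
Qed.

(** * Approximation by Taylor polynomials *)

Definition taylor_sum (R : realType) (a : nat -> R[i]) (n : nat) (z : R[i]) :=
  \sum_(k < n) a k * z ^+ k.

Lemma taylor_sum_cvg (R : realType) (a : nat -> R[i]) (f : R[i] -> R[i])
    (z : R[i]) (e : R) :
    analytic_on_disk a f -> cmod z < 1 -> 0 < e ->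
  exists N, forall n, (N <= n)%N -> cmod (f z - taylor_sum R a n z) < e.
Proof.
move=> fa z1 e0; have /cvgrPdist_lt /(_ e%:C) := fa z z1.
rewrite ltcR => /(_ e0) [N _ HN]; exists N => n Nn.
have := HN n Nn; rewrite /= /series /= big_mkord => h.
by rewrite -ltcR.
Qed.

Lemma taylor0 (R : realType) (a : nat -> R[i]) (f : R[i] -> R[i]) :
  analytic_on_disk a f -> f 0 = a 0%N.
Proof.
move=> fa; apply/eqP; rewrite -subr_eq0 -cmod_eq0 eq_le cmod_ge0 andbT.
apply/ler_addgt0Pr => e e0; rewrite add0r.
have [N HN] : exists N, forall n, (N <= n)%N -> cmod (f 0 - taylor_sum R a n 0) < e.
  by apply: taylor_sum_cvg; rewrite ?cmod0.
have := HN _ (leqnSn N); rewrite /taylor_sum big_ord_recl /= mulr1.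
rewrite big1 ?addr0 => [/ltW //|k _].
by rewrite exprS mul0r mulr0.
Qed.

(** Each term is a difference of two consecutive partial sums, and these are
    eventually both within 1/2 of the limit. *)
Lemma coef_eventually_small (R : realType) (a : nat -> R[i]) (f : R[i] -> R[i])
    (s : R) :
    analytic_on_disk a f -> 0 <= s < 1 ->
  exists N, forall k, (N <= k)%N -> cmod (a k) * s ^+ k <= 1.
Proof.
move=> fa /andP[s0 s1].
have s1' : cmod s%:C < 1 by rewrite cmod_real.
have e0 : 0 < 2^-1 :> R by rewrite invr_gt0.
have [N HN] := taylor_sum_cvg _ _ _ _ _ fa s1' e0.
exists N => k Nk; have h1 := HN k Nk; have h2 := HN _ (leqW Nk).
have -> : cmod (a k) * s ^+ k = cmod (a k * s%:C ^+ k) by rewrite cmodM cmodX cmod_real.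
have -> : a k * s%:C ^+ k =
  (f s%:C - taylor_sum R a k s%:C) - (f s%:C - taylor_sum R a k.+1 s%:C).
  by rewrite /taylor_sum [in RHS]big_ord_recr /=; ring.
have := cmodD _ (f s%:C - taylor_sum R a k s%:C) (- (f s%:C - taylor_sum R a k.+1 s%:C)).
rewrite cmodN; lra.
Qed.

(** Comparison with the geometric series of ratio |z| / s. The tail is first
    cut at a finite order, chosen by convergence at z. *)
Lemma taylor_remainder_bound (R : realType) (a : nat -> R[i])
    (f : R[i] -> R[i]) (z : R[i]) (s : R) (n : nat) :
    analytic_on_disk a f -> cmod z < s -> s < 1 ->
    (forall k, (n <= k)%N -> cmod (a k) * s ^+ k <= 1) ->
  cmod (f z - taylor_sum R a n z) <= (cmod z / s) ^+ n / (1 - cmod z / s).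
Proof.
move=> fa zs s1 Hs; set q := cmod z / s.
have z0 := cmod_ge0 _ z; have s0 : 0 < s by apply: le_lt_trans zs.
have q0 : 0 <= q by rewrite divr_ge0 // ltW.
have q1 : q < 1 by rewrite ltr_pdivrMr // mul1r.
apply/ler_addgt0Pr => e e0.
have [N HN] := taylor_sum_cvg _ _ _ _ _ fa (lt_trans zs s1) e0.
have := HN _ (leq_addl n N).
have -> : taylor_sum R a (n + N) z =
    taylor_sum R a n z + \sum_(k < N) a (n + k)%N * z ^+ (n + k).
  by rewrite /taylor_sum big_split_ord.
set T := \sum_(k < N) _ => HN'.
have HT : cmod T <= q ^+ n / (1 - q).
  apply: (le_trans (cmod_sum _ _ _)).
  apply: (@le_trans _ _ (\sum_(k < N) q ^+ n * q ^+ k)).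
    apply: ler_sum => k _; rewrite -exprD cmodM cmodX.
    have -> : cmod (a (n + k)%N) * cmod z ^+ (n + k) =
        cmod (a (n + k)%N) * s ^+ (n + k) * q ^+ (n + k).
      by rewrite -mulrA -exprMn /q mulrCA divff ?mulr1 // gt_eqF.
    by rewrite ler_piMl ?exprn_ge0 // Hs // leq_addr.
  rewrite -mulr_sumr ler_wpM2l ?exprn_ge0 //.
  rewrite -[leRHS]div1r ler_pdivlMr ?subr_gt0 // mulrC -opprB mulNr -subrX1 opprB.
  by rewrite gerBl exprn_ge0.
have := cmodD _ (f z - (taylor_sum R a n z + T)) T.
have -> : f z - (taylor_sum R a n z + T) + T = f z - taylor_sum R a n z by ring.
lra.
Qed.

(** Pointwise convergence at one point beyond the circle of radius r already
    gives uniform convergence on that circle, by the geometric bound on the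
    remainder. *)
Lemma taylor_sum_uniform (R : realType) (a : nat -> R[i]) (f : R[i] -> R[i])
    (r e : R) :
    analytic_on_disk a f -> 0 <= r < 1 -> 0 < e ->
  exists N, forall n z, (N <= n)%N -> cmod z = r ->
    cmod (f z - taylor_sum R a n z) <= e.
Proof.
move=> fa /andP[r0 r1] e0; pose s := (1 + r) / 2.
have rs : r < s by rewrite /s; lra.
have s1 : s < 1 by rewrite /s; lra.
have s0 : 0 <= s by lra.
pose q := r / s; have q0 : 0 <= q by rewrite divr_ge0.
have q1 : q < 1 by rewrite ltr_pdivrMr ?mul1r //; lra.
have [N1 H1] := coef_eventually_small _ _ _ s fa (introT andP (conj s0 s1)).
have e1 : 0 < e * (1 - q) by rewrite mulr_gt0 // subr_gt0.
have cq : (GRing.exp q @ \oo --> (0 : R))%classic by apply: cvg_expr; rewrite ger0_norm.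
have /cvgrPdist_lt /(_ _ e1) [N2 _ H2] := cq.
exists (maxn N1 N2) => n z; rewrite geq_max => /andP[n1 n2] zr.
have := taylor_remainder_bound _ a f z s n fa.
rewrite zr => /(_ rs s1 (fun k nk => H1 k (leq_trans n1 nk))) h.
apply: (le_trans h); rewrite -/q ler_pdivrMr ?subr_gt0 //.
have := H2 n n2; rewrite /= sub0r normrN ger0_norm ?exprn_ge0 // => /ltW //.
Qed.

(** The partial sum of f(z / M) / M. Shrinking both the argument and the
    value leaves room for the truncation error. *)
Definition scaled_taylor (R : realType) (a : nat -> R[i]) (M : R) (n : nat) :
  {poly R[i]} := \poly_(k < n) (a k * (M ^- k.+1)%:C).

Lemma coef_scaled_taylor (R : realType) (a : nat -> R[i]) (M : R) (n k : nat) :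
  0 < M -> (k < n)%N -> cmod (scaled_taylor R a M n)`_k = cmod (a k) / M ^+ k.+1.
Proof.
by move=> M0 kn; rewrite coef_poly kn cmodM cmod_real // invr_ge0 exprn_ge0 ?ltW.
Qed.

Lemma horner_scaled_taylor (R : realType) (a : nat -> R[i]) (M : R) (n : nat)
    (z : R[i]) : M != 0 ->
  (scaled_taylor R a M n).[M%:C * z] = (M^-1)%:C * taylor_sum R a n z.
Proof.
move=> M0; rewrite horner_poly mulr_sumr; apply: eq_bigr => k _.
have -> : (M^-1)%:C = (M ^- k.+1)%:C * M%:C ^+ k.
  rewrite -rmorphXn -rmorphM; congr (_%:C).
  by rewrite exprS invfM -mulrA mulVf ?mulr1 // expf_neq0.
rewrite exprMn; ring.
Qed.

(** On the circle of radius 1 / M the partial sums of f are eventually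
    within M - 1 of f, hence bounded by M. *)
Lemma scaled_taylor_le1 (R : realType) (a : nat -> R[i]) (f : R[i] -> R[i])
    (M : R) :
    bounded_analytic a f -> 1 < M ->
  exists N, forall n, (N <= n)%N ->
    forall z, cmod z = 1 -> cmod (scaled_taylor R a M n).[z] <= 1.
Proof.
move=> [fa f1] M1; have M0 : 0 < M by apply: lt_trans M1.
have r1 : 0 <= M^-1 < 1 by rewrite invr_ge0 ltW //= invf_lt1.
have e0 : 0 < M - 1 by rewrite subr_gt0.
have [N HN] := taylor_sum_uniform _ a f _ _ fa r1 e0.
exists N => n Nn z z1; pose y := (M^-1)%:C * z.
have ym : cmod y = M^-1 by rewrite cmodM cmod_real ?invr_ge0 ?ltW // z1 mulr1.
have -> : z = M%:C * y by rewrite /y mulrA -rmorphM divff ?gt_eqF // mul1r.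
rewrite horner_scaled_taylor ?gt_eqF // cmodM cmod_real ?invr_ge0 ?(ltW M0) //.
rewrite mulrC ler_pdivrMr // mul1r.
have h1 := HN n y Nn ym.
have h2 : cmod (f y) < 1 by apply: f1; rewrite ym; case/andP: r1.
have := cmodD _ (f y) (- (f y - taylor_sum R a n y)).
rewrite cmodN subKr; lra.
Qed.

(** * Wiener's inequality and the Schwarz-Pick inequality on the disk *)

Lemma le_right_limit (R : realType) (F : R -> R) (x c : R) :
    {for 1, continuous F} -> 1 < c ->
    (forall M, 1 < M -> M < c -> x <= F M) ->
  x <= F 1.
Proof.
move=> cF c1 h.
have cv : (F M @[M --> 1^'+] --> F 1)%classic by exact: cvg_at_right_filter.
rewrite -(cvg_lim _ cv) //; apply: limr_ge; first by apply/cvg_ex; exists (F 1).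
near=> M; apply: h => //.
Unshelve. all: by end_near. Qed.

(** The polynomial inequality for the scaled partial sums reads
    |a_(k+1)| <= M^(k+2) - |a_0|^2 M^k; then M tends to 1 from above. *)
Lemma wiener_coef_bound (R : realType) (a : nat -> R[i]) (f : R[i] -> R[i])
    (k : nat) :
  bounded_analytic a f -> cmod (a k.+1) <= 1 - cmod (a 0%N) ^+ 2.
Proof.
move=> fb; have [fa f1] := fb.
have A1 : cmod (a 0%N) < 1 by rewrite -(taylor0 _ _ _ fa) f1 ?cmod0.
pose F := fun M : R => M ^+ k.+2 - cmod (a 0%N) ^+ 2 * M ^+ k.
have -> : 1 - cmod (a 0%N) ^+ 2 = F 1 by rewrite /F !expr1n mulr1.
apply: (@le_right_limit _ F _ 2); rewrite ?ltr1n //.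
  apply: cvgB; first exact: exprn_continuous.
  by apply: cvgM; [exact: cvg_cst | exact: exprn_continuous].
move=> M M1 _; have M0 : 0 < M by apply: lt_trans M1.
have [N HN] := scaled_taylor_le1 _ _ _ _ fb M1.
have := wiener_poly _ (scaled_taylor R a M (N + k.+2)) k.+1 (HN _ (leq_addr _ _)).
rewrite !coef_scaled_taylor ?addnS ?ltnS ?leq_addl //.
rewrite expr1 ltr_pdivrMr // mul1r => /(_ (lt_trans A1 M1) isT).
rewrite ler_pdivrMr ?exprn_gt0 // => h; apply: (le_trans h).
rewrite le_eqVlt; apply/orP; left; apply/eqP; rewrite /F !exprS.
by field; rewrite gt_eqF.
Qed.

(** For w = M z the polynomial inequality becomes
    |f_n(z)| (1 + |a_0| |z|) <= |a_0| + M^2 |z|, where f_n is the partial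
    sum; first n tends to infinity, then M tends to 1. The bound 2 / (1 + |z|)
    on M keeps M z in the disk. *)
Lemma schwarz_pick (R : realType) (a : nat -> R[i]) (f : R[i] -> R[i])
    (z : R[i]) :
    bounded_analytic a f -> cmod z < 1 ->
  cmod (f z) * (1 + cmod (a 0%N) * cmod z) <= cmod (a 0%N) + cmod z.
Proof.
move=> fb z1; have [fa f1] := fb.
have A1 : cmod (a 0%N) < 1 by rewrite -(taylor0 _ _ _ fa) f1 ?cmod0.
set A := cmod (a 0%N) in A1 *; set r := cmod z in z1 *.
have A0 : 0 <= A := cmod_ge0 _ _; have r0 : 0 <= r := cmod_ge0 _ _.
pose F := fun M : R => A + M ^+ 2 * r.
have -> : A + r = F 1 by rewrite /F expr1n mul1r.
apply: (@le_right_limit _ F _ (2 / (1 + r))).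
- apply: cvgD; first exact: cvg_cst.
  by apply: cvgM; [exact: exprn_continuous | exact: cvg_cst].
- rewrite ltr_pdivlMr; lra.
move=> M M1; have M0 : 0 < M by apply: lt_trans M1.
rewrite ltr_pdivlMr ?(ltr_wpDr r0) // => Mr.
have Mr1 : M * r < 1 by lra.
have [N HN] := scaled_taylor_le1 _ _ _ _ fb M1.
apply/ler_addgt0Pr => e e0.
have e2 : 0 < e / 2 by rewrite divr_gt0.
have [N' HN'] := taylor_sum_cvg _ _ _ _ _ fa z1 e2.
pose n := (N + N').+1.
have nN : (N <= n)%N by rewrite ltnW // ltnS leq_addr.
have nN' : (N' <= n)%N by rewrite ltnW // ltnS leq_addl.
have := schwarz_pick_poly _ (scaled_taylor R a M n) (M%:C * z) (HN _ nN).
rewrite coef_scaled_taylor // expr1 cmodM (cmod_real _ _ (ltW M0)) -/A -/r.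
rewrite ltr_pdivrMr // mul1r => /(_ (lt_trans A1 M1) Mr1).
rewrite horner_scaled_taylor ?gt_eqF // cmodM cmod_real ?invr_ge0 ?(ltW M0) //.
set t := taylor_sum _ _ _ _ => h.
have {h} h : cmod t * (1 + A * r) <= F M.
  have := ler_wpM2l (ltW M0) h; congr (_ <= _); rewrite /F; field; rewrite gt_eqF //.
have := HN' n nN'; rewrite -/t => h'.
have := cmodD _ (f z - t) t; rewrite subrK => h3.
have : cmod (f z) * (1 + A * r) <= (e / 2 + cmod t) * (1 + A * r).
  by rewrite ler_wpM2r ?addr_ge0 ?mulr_ge0 //; lra.
have : A * r <= 1 by rewrite mulr_ile1 // ltW.
nra.
Qed.

(** * The Bohr radius *)

(** Rationalized form, in which the case p = 2 lam is no longer singular. *)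
Lemma bohr_radiusE (R : realType) (p lam : R) : 0 < p -> 0 < lam ->
  bohr_radius p lam = p / (p + lam + Num.sqrt (lam ^+ 2 + 4 * p * lam)).
Proof.
move=> p0 l0; rewrite /bohr_radius; set S := Num.sqrt _.
have S2 : S ^+ 2 = lam ^+ 2 + 4 * p * lam.
  by rewrite sqr_sqrtr // addr_ge0 ?sqr_ge0 // !mulr_ge0 // ltW.
have S0 : 0 <= S by exact: sqrtr_ge0.
have d0 : p + lam + S != 0 by rewrite gt_eqF //; lra.
case: eqP => [e|/eqP ne].
  have -> : S = 3 * lam.
    apply/eqP; rewrite -(@eqrXn2 _ 2) ?mulr_ge0 ?(ltW l0) // S2 e.
    by apply/eqP; ring.
  by rewrite e; field; apply/eqP; lra.
have ne' : 2 * lam - p != 0 by rewrite subr_eq0 eq_sym.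
apply/eqP; rewrite eqr_div //; apply/eqP.
rewrite (_ : _ * _ = S ^+ 2 - (p + lam) ^+ 2); last by ring.
by rewrite S2; ring.
Qed.

Lemma bohr_radius_lt1 (R : realType) (p lam : R) : 0 < p -> 0 < lam ->
  bohr_radius p lam < 1.
Proof.
move=> p0 l0; rewrite bohr_radiusE //; set S := Num.sqrt _.
have S0 : 0 <= S by exact: sqrtr_ge0.
rewrite ltr_pdivrMr; lra.
Qed.

(** The radius is the root in (0, 1) of 2 lam r (1 + r) = p (1 - r)^2. With
    S the square root, p times the difference of the two sides factors as
    (p - (p + lam + S) r) (p - (p + lam - S) r), and the second factor is
    positive on (0, 1) because lam <= S. *)
Lemma le_bohr_radius (R : realType) (p lam r : R) :
    0 < p -> 0 < lam -> 0 <= r < 1 ->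
  (r <= bohr_radius p lam) = (2 * lam * r * (1 + r) <= p * (1 - r) ^+ 2).
Proof.
move=> p0 l0 /andP[r0 r1]; rewrite bohr_radiusE //; set S := Num.sqrt _.
have S2 : S ^+ 2 = lam ^+ 2 + 4 * p * lam.
  by rewrite sqr_sqrtr // addr_ge0 ?sqr_ge0 // !mulr_ge0 // ltW.
have S0 : 0 <= S by exact: sqrtr_ge0.
have lS : lam <= S.
  by rewrite -ler_sqr ?nnegrE ?(ltW l0) // S2 lerDl !mulr_ge0 // ltW.
have d0 : 0 < p - (p + lam - S) * r by nra.
rewrite ler_pdivlMr; last by lra.
rewrite -subr_ge0 -(pmulr_lge0 _ d0) -[RHS]subr_ge0 -[RHS](pmulr_rge0 _ p0).
congr (0 <= _); apply/eqP; rewrite -subr_eq0; apply/eqP.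
transitivity (r ^+ 2 * (lam ^+ 2 + 4 * p * lam - S ^+ 2)); first by ring.
by rewrite S2 subrr mulr0.
Qed.

(** * The inequality inside the radius *)

(** Bernoulli's inequality for exponents at most 1, as Young's inequality for
    the product of y^q and 1 with conjugate exponents 1/q and 1/(1-q). *)
Lemma powR_le_tangent (R : realType) (y q : R) : 0 <= y -> 0 < q <= 1 ->
  y `^ q <= 1 + q * (y - 1).
Proof.
move=> y0 /andP[q0]; rewrite le_eqVlt => /predU1P[->|q1].
  by rewrite powRr1 // mul1r addrCA subrr addr0.
have q1' : 0 < 1 - q by rewrite subr_gt0.
have := @conjugate_powR R (y `^ q) 1 q^-1 (1 - q)^-1 (powR_ge0 _ _) ler01.
rewrite !invr_gt0 => /(_ q0 q1'); rewrite !invrK addrC subrK => /(_ erefl).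
rewrite mulr1 -powRrM divff ?gt_eqF // powRr1 // powR1; lra.
Qed.

(** The exponent p = 2 controls all smaller exponents, because y^(p/2) is
    concave in y = b^2. *)
Lemma powR_le_sqr (R : realType) (b p : R) : 0 <= b -> 0 < p <= 2 ->
  b `^ p <= 1 - p / 2 * (1 - b ^+ 2).
Proof.
move=> b0 /andP[p0 p2].
have -> : b `^ p = (b ^+ 2) `^ (p / 2).
  by rewrite -powR_mulrn // -powRrM mulrC divfK // gt_eqF.
have := @powR_le_tangent R (b ^+ 2) (p / 2) (sqr_ge0 _).
rewrite divr_gt0 // ler_pdivrMr // mul1r p2 => /(_ isT); lra.
Qed.

(** At b = (a + r) / (1 + a r) the defect 1 - b^2 equals
    (1 - a^2)(1 - r^2) / (1 + a r)^2, and 1 + a r <= 1 + r. *)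
Lemma schwarz_pick_defect (R : realFieldType) (a b r : R) :
    0 <= a <= 1 -> 0 <= b -> 0 <= r < 1 -> b * (1 + a * r) <= a + r ->
  (1 - a ^+ 2) * (1 - r) / (1 + r) <= 1 - b ^+ 2.
Proof.
move=> /andP[a0 a1] b0 /andP[r0 r1] h.
have ar : 0 <= a * r by rewrite mulr_ge0.
have d0 : 0 < 1 + a * r by rewrite ltr_wpDr.
have a2 : 0 <= 1 - a ^+ 2 by rewrite subr_ge0 expr_le1.
have h2 : b ^+ 2 * (1 + a * r) ^+ 2 <= (a + r) ^+ 2.
  by rewrite -exprMn lerXn2r ?nnegrE ?mulr_ge0 ?addr_ge0.
have h3 : (1 + a * r) ^+ 2 <= (1 + r) ^+ 2.
  by rewrite lerXn2r ?nnegrE ?addr_ge0 // lerD2l ler_piMl.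
rewrite ler_pdivrMr ?(ltr_wpDr r0) //.
rewrite -(ler_pM2r (exprn_gt0 2 d0)).
have h4 : (1 - r) * ((1 - a ^+ 2) * (1 + a * r) ^+ 2) <=
          (1 - r) * ((1 - a ^+ 2) * (1 + r) ^+ 2).
  by rewrite !ler_wpM2l // subr_ge0 ltW.
nra.
Qed.

Lemma nneseries_coef_le (R : realType) (c : nat -> R) (K r : R) :
    0 <= r < 1 -> (forall k, 0 <= c k) -> (forall k, c k.+1 <= K) ->
  (\sum_(1 <= k <oo) (c k * r ^+ k)%:E <= (K * (r / (1 - r)))%:E)%E.
Proof.
move=> /andP[r0 r1] c0 cK; apply: lime_le.
  by apply: is_cvg_nneseries => n _ _; rewrite lee_fin mulr_ge0 ?exprn_ge0.
apply: nearW => n; rewrite sumEFin lee_fin.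
have K0 : 0 <= K := le_trans (c0 1%N) (cK 0%N).
apply: (@le_trans _ _ (\sum_(1 <= k < n) K * r ^+ k)).
  rewrite !big_nat; apply: ler_sum => -[|k] //= _.
  by rewrite ler_wpM2r ?exprn_ge0.
rewrite -mulr_sumr ler_wpM2l //.
case: n => [|n]; first by rewrite big_geq // divr_ge0 // subr_ge0 ltW.
rewrite big_add1 /= big_mkord; under eq_bigr do rewrite exprS.
rewrite -mulr_sumr ler_wpM2l // -[leRHS]div1r ler_pdivlMr ?subr_gt0 //.
rewrite mulrC -opprB mulNr -subrX1 opprB.
by rewrite gerBl exprn_ge0.
Qed.

(** With a = |a_0| and r = |z|, the defect 1 - |f(z)|^p is at least
    (p/2) (1 - a^2) (1 - r) / (1 + r) and the series is at most
    lam (1 - a^2) r / (1 - r). The common factor 1 - a^2 cancels, and what is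
    left is the inequality that defines the radius. *)
Lemma bohr_inequality_within_radius (R : realType) (p lam : R)
    (a : nat -> R[i]) (f : R[i] -> R[i]) (z : R[i]) :
    0 < p <= 2 -> 0 < lam -> bounded_analytic a f ->
    cmod z <= bohr_radius p lam ->
  bohr_inequality p lam a f z.
Proof.
move=> p02 l0 fb zR; have [fa f1] := fb; have /andP[p0 p2] := p02.
have z0 := cmod_ge0 _ z.
have z1 : cmod z < 1 := le_lt_trans zR (bohr_radius_lt1 _ _ _ p0 l0).
have A1 : cmod (a 0%N) < 1 by rewrite -(taylor0 _ _ _ fa) f1 ?cmod0.
have A0 := cmod_ge0 _ (a 0%N).
have SP := schwarz_pick _ _ _ _ fb z1.
have Q := schwarz_pick_defect _ _ _ _ (introT andP (conj A0 (ltW A1)))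
  (cmod_ge0 _ (f z)) (introT andP (conj z0 z1)) SP.
move: zR; rewrite le_bohr_radius ?z0 // => zR.
have B := powR_le_sqr _ _ _ (cmod_ge0 _ (f z)) p02.
have N := nneseries_coef_le R (fun k => cmod (a k)) (1 - cmod (a 0%N) ^+ 2) (cmod z)
  (introT andP (conj z0 z1)) (fun k => cmod_ge0 _ _)
  (fun k => wiener_coef_bound _ _ _ k fb).
rewrite /bohr_inequality.
set r := cmod z in z0 z1 SP Q zR N *; set A := cmod (a 0%N) in A1 A0 SP Q N *.
have H : cmod (f z) `^ p + lam * ((1 - A ^+ 2) * (r / (1 - r))) <= 1.
  have a2 : 0 <= 1 - A ^+ 2 by rewrite subr_ge0 expr_le1 // ltW.
  have h1 : lam * (r / (1 - r)) <= p / 2 * ((1 - r) / (1 + r)).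
    rewrite !mulrA ler_pdivrMr ?subr_gt0 // mulrAC ler_pdivlMr ?ltr_wpDr //.
    nra.
  have h2 := ler_wpM2l a2 h1.
  have h3 : p / 2 * ((1 - A ^+ 2) * (1 - r) / (1 + r)) <= p / 2 * (1 - cmod (f z) ^+ 2).
    by rewrite ler_wpM2l // divr_ge0 // ltW.
  nra.
apply: (@le_trans _ _ (cmod (f z) `^ p
    + lam * ((1 - A ^+ 2) * (r / (1 - r))))%:E); last by rewrite lee_fin.
by rewrite EFinD leeD2l // EFinM lee_pmul2l // lte_fin.
Qed.

(** * Sharpness *)

(** This lower bound has the first order expansion of x^p at 1 and holds for
    every p > 0: x^p = exp (p ln x) >= 1 + p ln x and ln x >= 1 - 1/x. *)
Lemma powR_ge_tangent (R : realType) (x p : R) : 0 < x -> 0 < p ->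
  1 - p * (1 - x) / x <= x `^ p.
Proof.
move=> x0 p0; rewrite /powR gt_eqF //; apply: le_trans (expR_ge1Dx _).
rewrite lerD2l.
have := @le_ln1Dx R (x^-1 - 1).
rewrite [1 + _]addrC subrK ltrBrDl addrN invr_gt0 x0 lnV // => /(_ isT) h.
have -> : - (p * (1 - x) / x) = p * - (x^-1 - 1) by field; rewrite gt_eqF.
by rewrite ler_pM2l // lerNl.
Qed.

(** The automorphism of the disk with f(0) = t, for which Schwarz-Pick is an
    equality at positive z and all Wiener bounds are attained to first order
    as t tends to 1. *)
Definition mobius (R : realType) (t : R) (z : R[i]) : R[i] :=
  (t%:C + z) / (1 + t%:C * z).

Definition mobius_coef (R : realType) (t : R) (k : nat) : R[i] :=
  if k is j.+1 then ((1 - t ^+ 2) * (- t) ^+ j)%:C else t%:C.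

Lemma mobius_denom_neq0 (R : realType) (t : R) (z : R[i]) :
  0 < t < 1 -> cmod z < 1 -> 1 + t%:C * z != 0.
Proof.
move=> /andP[t0 t1] z1; rewrite -cmod_eq0 gt_eqF //.
have := cmodD _ (1 + t%:C * z) (- (t%:C * z)).
rewrite addrK cmod1 cmodN cmodM cmod_real ?(ltW t0) //.
have := cmod_ge0 _ z; nra.
Qed.

Lemma mobius_remainder (R : realType) (t : R) (z : R[i]) (n : nat) :
    0 < t < 1 -> cmod z < 1 ->
  mobius R t z - taylor_sum R (mobius_coef R t) n.+1 z =
    (1 - t ^+ 2)%:C * z / (1 + t%:C * z) * (- (t%:C * z)) ^+ n.
Proof.
move=> t01 z1; have d0 := mobius_denom_neq0 _ _ _ t01 z1.
rewrite /taylor_sum big_ord_recl /= mulr1.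
pose q := - (t%:C * z).
have -> : \sum_(k < n) ((1 - t ^+ 2) * (- t) ^+ k)%:C * z ^+ k.+1 =
    (1 - t ^+ 2)%:C * z * \sum_(k < n) q ^+ k.
  rewrite mulr_sumr; apply: eq_bigr => k _.
  rewrite /q -[- (_ * z)]mulNr exprMn rmorphM rmorphXn rmorphN [z ^+ k.+1]exprS /=; ring.

have -> : \sum_(k < n) q ^+ k = (1 - q ^+ n) / (1 + t%:C * z).
  apply: (canRL (mulfK d0)); rewrite mulrC.
  have -> : 1 + t%:C * z = - (q - 1) by rewrite /q; ring.
  by rewrite mulNr -subrX1 opprB.
rewrite -/q /mobius rmorphB rmorphXn rmorph1 /=; field.
exact: d0.
Qed.

(** The bound on the disk is the identity
    |1 + t z|^2 - |t + z|^2 = (1 - t^2) (1 - |z|^2). *)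
Lemma mobius_bounded_analytic (R : realType) (t : R) :
  0 < t < 1 -> bounded_analytic (mobius_coef R t) (mobius R t).
Proof.
move=> t01; have /andP[t0 t1] := t01; split=> z z1; last first.
  have d0 := mobius_denom_neq0 _ _ _ t01 z1.
  rewrite /mobius cmodM [X in _ * X]ComplexField.Normc.normcV -/(cmod _).
  rewrite ltr_pdivrMr ?mul1r; last by rewrite lt_def cmod_eq0 d0 cmod_ge0.
  rewrite -ltr_sqr ?nnegrE ?cmod_ge0 // -subr_gt0 !sqr_cmod.
  have : 0 < (1 - t ^+ 2) * (1 - cmod z ^+ 2).
    by rewrite mulr_gt0 // subr_gt0 expr_lt1 ?cmod_ge0 ?(ltW t0).
  congr (0 < _); rewrite sqr_cmod; case: (z) => x y /=; ring.
apply/cvgrPdist_lt => e e0.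
have [e' Ee] : exists e' : R, e = e'%:C.
  by case: e e0 => x y; rewrite ltcE /= => /andP[/eqP -> _]; exists x.
rewrite Ee ltcR in e0 *.
pose K := cmod ((1 - t ^+ 2)%:C * z / (1 + t%:C * z)).
pose q := cmod (- (t%:C * z)).
have q1 : `|q| < 1.
  rewrite ger0_norm ?cmod_ge0 // /q cmodN cmodM cmod_real ?(ltW t0) //.
  by rewrite mulr_ilt1 ?cmod_ge0 // ltW.
have cq : ((fun n => K * q ^+ n) @ \oo --> K * 0)%classic.
  by apply: cvgMr; exact: cvg_expr.
rewrite mulr0 in cq; have /cvgrPdist_lt /(_ _ e0) [N _ HN] := cq.
exists N.+1 => // -[//|n] Nn /=; rewrite /series /= big_mkord.
rewrite -[X in `|_ - X|]/(taylor_sum R (mobius_coef R t) n.+1 z).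
rewrite mobius_remainder // normE_cmod ltcR cmodM cmodX -/K -/q.
have := HN n Nn; rewrite /= sub0r normrN ger0_norm //.
by rewrite mulr_ge0 ?exprn_ge0 ?cmod_ge0.
Qed.

(** To first order in 1 - t the left side minus 1 is
    (1 - t) (2 lam r / (1 - r) - p (1 - r) / (1 + r)), which is positive
    beyond the radius; t only has to be close enough to 1. *)
Lemma sharpness_gap (R : realType) (p lam r : R) :
    0 < p -> 0 < lam -> 0 < r < 1 -> p * (1 - r) ^+ 2 < 2 * lam * r * (1 + r) ->
  exists2 t : R, 0 < t < 1 &
    1 < ((t + r) / (1 + t * r)) `^ p
        + lam * ((1 - t ^+ 2) * (r / (1 - t * r))).
Proof.
move=> p0 l0 /andP[r0 r1] gap.
(* At t = 1 - d, the inequality to be proved, multiplied out and divided by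
   1 - t, has a gap of at least D - d (4 lam r + p); the value of d makes this
   bound positive and keeps d < 1. *)
pose D := 2 * lam * r * (1 + r) - p * (1 - r) ^+ 2.
have D0 : 0 < D by rewrite subr_gt0.
pose d := D / (D + 4 * lam + p).
have den0 : 0 < D + 4 * lam + p by lra.
have d0 : 0 < d by rewrite divr_gt0.
have d1 : d < 1 by rewrite ltr_pdivrMr // mul1r; lra.
have dD : d * (4 * lam * r + p) < D.
  rewrite /d mulrAC ltr_pdivrMr // ltr_pM2l //; nra.
clearbody d; have [t td] : exists t, t = 1 - d by exists (1 - d).
exists t; first by rewrite td; lra.
have t01 : 0 < t < 1 by rewrite td; lra.
have /andP[t0 t1] := t01.
have tr : 0 < t * r by rewrite mulr_gt0.
have tr1 : t * r < 1 by rewrite mulr_ilt1 // ltW.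
set x := (t + r) / (1 + t * r).
have x0 : 0 < x by rewrite divr_gt0; lra.
have := powR_ge_tangent _ _ _ x0 p0.
suff : p * (1 - x) / x < lam * ((1 - t ^+ 2) * (r / (1 - t * r))) by lra.
have -> : p * (1 - x) / x = p * ((1 - t) * (1 - r)) / (t + r).
  rewrite /x; field; apply/andP; split; rewrite gt_eqF //; lra.
rewrite ltr_pdivrMr; last by lra.
have -> : lam * ((1 - t ^+ 2) * (r / (1 - t * r))) * (t + r) =
    (1 - t) * (lam * (1 + t) * r * (t + r)) / (1 - t * r) by ring.
rewrite ltr_pdivlMr ?subr_gt0 //.
have -> : p * ((1 - t) * (1 - r)) * (1 - t * r) =
    (1 - t) * (p * (1 - r) * (1 - t * r)) by ring.
rewrite ltr_pM2l ?subr_gt0 //.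
suff : 0 < lam * (1 + t) * r * (t + r) - p * (1 - r) * (1 - t * r) by lra.
have -> : lam * (1 + t) * r * (t + r) - p * (1 - r) * (1 - t * r) =
   D - d * (4 * lam * r + p) + lam * r * d * (1 - r + d) + p * d * (1 - r * (1 - r)).
  by rewrite td /D; ring.
have h1 : 0 <= lam * r * d * (1 - r + d).
  by rewrite !mulr_ge0 ?(ltW l0) ?(ltW r0) ?(ltW d0) //; lra.
have h2 : 0 <= p * d * (1 - r * (1 - r)).
  by rewrite !mulr_ge0 ?(ltW p0) ?(ltW d0) // subr_ge0 mulr_ile1 //
     ?subr_ge0 ?gerBl ?(ltW r0) ?(ltW r1).
lra.
Qed.

(** The moduli of the coefficients form a geometric progression, and the
    sum of the first m terms is (1 - t^2) r / (1 - t r) times 1 - (t r)^m. *)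
Lemma bohr_inequality_mobius_fails (R : realType) (p lam r t : R) :
    0 < lam -> 0 < r < 1 -> 0 < t < 1 ->
    1 < ((t + r) / (1 + t * r)) `^ p
        + lam * ((1 - t ^+ 2) * (r / (1 - t * r))) ->
  ~ bohr_inequality p lam (mobius_coef R t) (mobius R t) r%:C.
Proof.
move=> l0 /andP[r0 r1] /andP[t0 t1] gap.
have tr0 : 0 <= t * r by rewrite mulr_ge0 // ltW.
have tr1 : t * r < 1 by rewrite mulr_ilt1 // ltW.
rewrite /bohr_inequality cmod_real ?(ltW r0) //.
have -> : cmod (mobius R t r%:C) = (t + r) / (1 + t * r).
  have -> : mobius R t r%:C = ((t + r) / (1 + t * r))%:C.
    by rewrite /mobius fmorph_div !rmorphD rmorph1 rmorphM.
  by rewrite cmod_real // divr_ge0 ?addr_ge0 // ltW.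
set X := _ `^ p in gap *; set G := (1 - t ^+ 2) * _ in gap.
set s := (\sum_(1 <= k <oo) _)%E => h.
suff : X + lam * G - 1 <= 0 by lra.
apply: (@le0_geometric_bound _ (t * r) _ (lam * G)); first by rewrite tr0.
move=> m; have hs : ((G * (1 - (t * r) ^+ m.+1))%:E <= s)%E.
  apply: le_trans (nneseries_lim_ge m.+2 _); last first.
    by move=> n _ _; rewrite lee_fin mulr_ge0 ?cmod_ge0 ?exprn_ge0 // ltW.
  rewrite sumEFin lee_fin le_eqVlt; apply/orP; left; apply/eqP.
  rewrite big_add1 [m.+2.-1]/= big_mkord.
  have a2 : 0 <= 1 - t ^+ 2 by rewrite subr_ge0 expr_le1 // ltW.
  transitivity (\sum_(i < m.+1) (1 - t ^+ 2) * r * (t * r) ^+ i).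
    rewrite -mulr_sumr; apply: (mulIf (x := 1 - t * r)).
      by rewrite gt_eqF // subr_gt0.
    transitivity ((1 - t ^+ 2) * r * (1 - (t * r) ^+ m.+1)).
      by rewrite /G; field; rewrite gt_eqF // subr_gt0.
    rewrite -[RHS]mulrA; congr (_ * _).
    by rewrite [RHS]mulrC -[1 - t * r]opprB mulNr -subrX1 opprB.
  apply: eq_bigr => i _.
  have -> : cmod (mobius_coef R t i.+1) = (1 - t ^+ 2) * t ^+ i.
    rewrite -[mobius_coef R t i.+1]/(_%:C) rmorphM cmodM cmod_real //.
    by rewrite rmorphXn cmodX rmorphN cmodN cmod_real // ltW.
  by rewrite exprMn [r ^+ i.+1]exprS; ring.
have : (X%:E + lam%:E * (G * (1 - (t * r) ^+ m.+1))%:E <= 1)%E.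
  by apply: le_trans h; rewrite leeD2l // lee_pmul2l // lte_fin.
rewrite -EFinM -EFinD lee_fin; lra.
Qed.

Theorem theorem3p1 (R : realType) (p lam : R)
    (hplam : region_I p lam \/ region_II p lam) :
  (forall (a : nat -> R[i]) (f : R[i] -> R[i]), bounded_analytic a f ->
     forall z : R[i], cmod z <= bohr_radius p lam ->
       bohr_inequality p lam a f z) /\
  (forall R' : R, bohr_radius p lam < R' -> R' < 1 ->
     exists (a : nat -> R[i]) (f : R[i] -> R[i]) (z : R[i]),
       [/\ bounded_analytic a f, cmod z <= R' &
           ~ bohr_inequality p lam a f z]).
Proof.
have [p02 l0] : 0 < p <= 2 /\ 0 < lam.
  by case: hplam => -[/andP[? ?]]; [|move=> /andP[? ?]]; split; lra.
have /andP[p0 _] := p02; split.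
  by move=> a f fb z; exact: bohr_inequality_within_radius.
move=> r Rr r1.
have r0 : 0 < r.
  apply: le_lt_trans Rr; rewrite le_bohr_radius // ?lexx ?ltr01 //.
  by rewrite mulr0 mul0r subr0 expr1n mulr1 ltW.
have gap : p * (1 - r) ^+ 2 < 2 * lam * r * (1 + r).
  by rewrite ltNge -le_bohr_radius ?(ltW r0) // -ltNge.
have r01 : 0 < r < 1 by rewrite r0.
have [t t01 ht] := sharpness_gap _ _ _ _ p0 l0 r01 gap.
exists (mobius_coef R t), (mobius R t), r%:C; split.
- exact: mobius_bounded_analytic.
- by rewrite cmod_real // ltW.
- exact: bohr_inequality_mobius_fails.
Qed.
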